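(* Let $\mathsf{G}$ be a connected weighted graph on $n\ge2$ vertices with Laplacian $A$, and let $\mathsf{G}_D$, with Laplacian $A_D\in\mathbb{R}^{N\times N}$, be obtained by disaggregating the first $m$ vertices of $\mathsf{G}$ into $d_1,\dots,d_m$ vertices. Let $\widetilde{A}_D=D_s^{-1}A_DD_s^{-1}$ and $\widetilde{P}=D_sP$. Let $\epsilon>0$ and suppose that for every $k=1,\dots,m$ every internal edge $e'=(p,q)\in E_a^k$ has weight $$\omega_{e'}\ \ge\ W_{e'}:=(1+\epsilon^{-1})\left[\sum_{\substack{e=(i,j)\in E_D^1\\ i\in V^0,\ j\in V_a^k}}\omega_eW_k^j+2\sum_{\ell=1}^m\left(\sum_{\substack{e=(i,j)\in E_D^2\\ i\in V_a^k,\ j\in V_a^\ell}}\omega_eW_k^i+\sum_{\substack{e=(i,j)\in E_D^2\\ i\in V_a^\ell,\ j\in V_a^k}}\omega_eW_k^j\right)\right].$$ Let $\widetilde{B}_D\in\mathbb{R}^{N\times N}$ be symmetric positive definite (a preconditioner for $\widetilde{A}_D$). Then the preconditioner $B=\widetilde{P}^T\widetilde{B}_D\widetilde{P}$ for $A$ satisfies $$\kappa(BA)\le(1+\epsilon)\,\kappa(\widetilde{B}_D\widetilde{A}_D).$$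
   Context: All graphs are finite, simple, undirected, with positive edge weights $\omega_e$. The Laplacian $A$ of $\mathsf{G}=(V,E,\omega)$ is the symmetric matrix with $\langle A\bm{u},\bm{v}\rangle=\sum_{e=(i,j)\in E}\omega_e(u_i-u_j)(v_i-v_j)$. Disaggregating the vertices $1,\dots,m$ of $\mathsf{G}$ into $d_1,\dots,d_m$ vertices: vertex $k\le m$ is replaced by a set $V_a^k$ of $d_k$ new vertices, and the set $V^0$ of the remaining $n-m$ vertices is kept, so the new graph $\mathsf{G}_D$ has $N=n-m+\sum_k d_k$ vertices. Each edge of $\mathsf{G}$ gives exactly one edge of $\mathsf{G}_D$ of the same weight, where any endpoint $k\le m$ is replaced by one (arbitrarily chosen) vertex of $V_a^k$; in addition a connected graph $\mathsf{G}_a^k=(V_a^k,E_a^k,\omega_a^k)$ with positive edge weights (internal edges) is placed on each $V_a^k$. The vertices of $\mathsf{G}_D$ are ordered as $V_a^1,\dots,V_a^m$, then $V^0$. $P=\begin{pmatrix}P_m&0\\0&I_{(n-m)\times(n-m)}\end{pmatrix}\in\mathbb{R}^{N\times n}$, where $P_m$ is block diagonal with diagonal blocks the all-ones column vectors $\bm{1}_{d_1},\dots,\bm{1}_{d_m}$. $D_s=\operatorname{diag}(d_1^{-1/2}I_{d_1\times d_1},\dots,d_m^{-1/2}I_{d_m\times d_m},I_{(n-m)\times(n-m)})$. $E_D^1$ is the set of edges of $\mathsf{G}_D$ joining $V^0$ to some $V_a^k$ (written $(i,j)$ with $i\in V^0$); $E_D^2$ is the set of edges of $\mathsf{G}_D$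 joining $V_a^k$ to $V_a^\ell$ with $k\ne\ell$, each undirected edge being written once as a pair $(i,j)$ in an arbitrary fixed order. $L_k$ is the unweighted Laplacian of $\mathsf{G}_a^k$ (all edge weights set to $1$), $L_{k,j}=L_k+\bm{e}_j\bm{e}_j^T$ for $j\in V_a^k$ (with $\bm{e}_j$ the standard basis vector of $\mathbb{R}^{d_k}$; $L_{k,j}$ is invertible), and $W_k^j=\frac1{d_k^2}\|L_{k,j}^{-1}\bm{1}_{d_k}\|_{L_k}^2$, where $\|\bm{x}\|_{M}^2=\langle M\bm{x},\bm{x}\rangle$. For a product $BA$ of a symmetric positive definite $B$ and a nonzero symmetric positive semidefinite $A$, $\kappa(BA)$ is the ratio of the largest eigenvalue to the smallest nonzero eigenvalue of $BA$. *)

(* Defs.v *)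
From mathcomp Require Export all_boot all_order all_algebra.
From mathcomp Require Export boolp classical_sets reals.

Set Implicit Arguments.
Unset Strict Implicit.
Unset Printing Implicit Defensive.

Import Order.TTheory GRing.Theory Num.Theory.
Local Open Scope ring_scope.

(* A simple undirected graph on 'I_n with positive edge weights is encoded by
   its weight function extended by 0 outside the edge set; the edges are thus
   the pairs of positive weight. *)
Record wgraph (R : realType) (n : nat) := WGraph {
  wt :> 'I_n -> 'I_n -> R;
  wt_sym : forall x y, wt x y = wt y x;
  wt_loopless : forall x, wt x x = 0;
  wt_ge0 : forall x y, 0 <= wt x y
}.

Section Graphs.
Variables (R : realType) (n : nat).
Implicit Types (G : wgraph R n) (u v : 'cV[R]_n).

Definition edge G : rel 'I_n := fun x y => 0 < wt G x y.

Definition connected_graph G : Prop :=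
  (0 < n)%N /\ forall x y, connect (edge G) x y.

Definition dot u v : R := (u^T *m v) 0 0.

(* The condition i < j lists each undirected edge once. *)
Definition laplacian_form G u v : R :=
  \sum_(i < n) \sum_(j < n | (i < j)%N && edge G i j)
    wt G i j * (u i 0 - u j 0) * (v i 0 - v j 0).

(* The matrix of the bilinear form above in the standard basis. *)
Definition laplacian G : 'M[R]_n :=
  \matrix_(i, j) laplacian_form G (delta_mx j 0) (delta_mx i 0).

Lemma laplacianP G u v : dot (laplacian G *m u) v = laplacian_form G u v.
Proof.
have decomp (x : 'cV[R]_n) a b :
    x a 0 - x b 0
    = \sum_k x k 0 * ((delta_mx k 0 : 'cV[R]_n) a 0
                      - (delta_mx k 0 : 'cV[R]_n) b 0).
  under eq_bigr => k _ do rewrite mulrBr.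
  rewrite big_split /= sumrN; congr (_ - _).
    rewrite (bigD1 a) //= big1 ?mxE ?eqxx ?mulr1 ?addr0 // => k /negbTE ka.
    by rewrite mxE eq_sym ka mulr0.
  rewrite (bigD1 b) //= big1 ?mxE ?eqxx ?mulr1 ?addr0 // => k /negbTE kb.
  by rewrite mxE eq_sym kb mulr0.
have step i : \sum_j laplacian G i j * u j 0
             = laplacian_form G u (delta_mx i 0).
  under eq_bigr => j _ do rewrite mxE mulr_suml.
  rewrite exchange_big; apply: eq_bigr => a _ /=.
  under eq_bigr => j _ do rewrite mulr_suml.
  rewrite exchange_big; apply: eq_bigr => b _ /=.
  rewrite [u a 0 - _]decomp mulr_sumr mulr_suml; apply: eq_bigr => j _.
  by rewrite -!mulrA; congr (_ * _); rewrite mulrA mulrC.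
rewrite /dot mxE.
under eq_bigr => i _ do rewrite mxE mxE step mulr_suml.
rewrite exchange_big; apply: eq_bigr => a _ /=.
under eq_bigr => i _ do rewrite mulr_suml.
rewrite exchange_big; apply: eq_bigr => b _ /=.
rewrite [v a 0 - _]decomp mulr_sumr; apply: eq_bigr => i _.
by rewrite -mulrA [(_ - _) * v i 0]mulrC.
Qed.

Definition sqnorm (M : 'M[R]_n) (x : 'cV[R]_n) : R := dot (M *m x) x.

Definition spd (M : 'M[R]_n) : Prop :=
  M^T = M /\ forall x : 'cV[R]_n, x != 0 -> 0 < dot (M *m x) x.

(* The eigenvalue predicate of the library uses row eigenvectors; this does
   not change the spectrum. The sets below are finite, and they are nonempty
   when M is the product of a symmetric positive definite matrix and a nonzero
   symmetric positive semidefinite one, so that sup and inf are then the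
   largest and the smallest element. *)
Definition cond_number (M : 'M[R]_n) : R :=
  sup [set a : R | eigenvalue M a]%classic
  / inf [set a : R | eigenvalue M a /\ a != 0]%classic.

Lemma unweighted_sym G x y : (edge G x y)%:R = (edge G y x)%:R :> R.
Proof. by rewrite /edge wt_sym. Qed.

Lemma unweighted_loopless G x : (edge G x x)%:R = 0 :> R.
Proof. by rewrite /edge wt_loopless ltxx. Qed.

Lemma unweighted_ge0 G x y : 0 <= (edge G x y)%:R :> R.
Proof. exact: ler0n. Qed.

Definition unweighted G : wgraph R n :=
  WGraph (unweighted_sym G) (unweighted_loopless G) (unweighted_ge0 G).

End Graphs.

Section Disaggregation.
Variables (R : realType) (m n0 : nat) (d : 'I_m -> nat).

(* The aggregated graph has the n = m + n0 vertices 'I_(m + n0), of which the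
   first m are disaggregated; the N vertices of the new graph are ordered as
   V_a^1, ..., V_a^m, V^0. *)
Notation N := (\sum_(k < m) d k + n0)%N.

Definition va (k : 'I_m) (p : 'I_(d k)) : 'I_N :=
  lshift n0 (@tagnat.Rank m d k p).

Definition v0 (i : 'I_n0) : 'I_N := rshift (\sum_(k < m) d k)%N i.

Definition parent (x : 'I_N) : 'I_(m + n0) :=
  match split x with
  | inl p => lshift n0 (tagnat.sig1 p)
  | inr i => rshift m i
  end.

Section Internal.
Variables (GD : wgraph R N) (k : 'I_m).

Definition internal_wt (p q : 'I_(d k)) : R := wt GD (va p) (va q).

Lemma internal_wt_sym p q : internal_wt p q = internal_wt q p.
Proof. exact: wt_sym. Qed.

Lemma internal_wt_loopless p : internal_wt p p = 0.
Proof. exact: wt_loopless. Qed.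

Lemma internal_wt_ge0 p q : 0 <= internal_wt p q.
Proof. exact: wt_ge0. Qed.

(* G_a^k, recovered from G_D as the induced subgraph on V_a^k. *)
Definition internal : wgraph R (d k) :=
  WGraph internal_wt_sym internal_wt_loopless internal_wt_ge0.

End Internal.

(* r u v is the vertex replacing the endpoint u of the edge {u, v} of G; its
   value is irrelevant when u and v are not adjacent. The edges of G_D inside
   the sets V_a^k are constrained only by the connectedness of internal GD k,
   which also forces 0 < d k. *)
Definition is_disaggregation (G : wgraph R (m + n0)) (GD : wgraph R N) : Prop :=
  (exists r : 'I_(m + n0) -> 'I_(m + n0) -> 'I_N,
     (forall u v, parent (r u v) = u) /\
     (forall x y, parent x != parent y ->
        wt GD x y =
          if (x == r (parent x) (parent y)) && (y == r (parent y) (parent x))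
          then wt G (parent x) (parent y) else 0)) /\
  (forall k : 'I_m, connected_graph (internal GD k)).

Definition Pmx : 'M[R]_(N, m + n0) :=
  block_mx (\mxcol_(k < m) \matrix_(p < d k, l < m) (l == k)%:R) 0
           0 1%:M.

Definition Dsmx : 'M[R]_N :=
  block_mx (\mxdiag_(k < m) (Num.sqrt (d k)%:R)^-1%:M) 0
           0 1%:M.

(* E2 contains exactly one of the pairs (x, y), (y, x) for each edge of GD
   joining V_a^k to V_a^l with k != l, and no other pair. *)
Definition is_oriented_E2 (GD : wgraph R N) (E2 : rel 'I_N) : Prop :=
  (forall x y, E2 x y ->
     exists k l (p : 'I_(d k)) (q : 'I_(d l)),
       [/\ x = va p, y = va q, k != l & edge GD x y]) /\
  (forall k l (p : 'I_(d k)) (q : 'I_(d l)),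
     k != l -> edge GD (va p) (va q) ->
     E2 (va p) (va q) (+) E2 (va q) (va p)).

Definition Lk (GD : wgraph R N) (k : 'I_m) : 'M[R]_(d k) :=
  laplacian (unweighted (internal GD k)).

Definition Lkj (GD : wgraph R N) (k : 'I_m) (j : 'I_(d k)) : 'M[R]_(d k) :=
  Lk GD k + delta_mx j j.

Definition Wkj (GD : wgraph R N) (k : 'I_m) (j : 'I_(d k)) : R :=
  ((d k)%:R ^+ 2)^-1 *
  sqnorm (Lk GD k) (invmx (Lkj GD j) *m (const_mx 1 : 'cV[R]_(d k))).

(* W_{e'}, which depends on e' only through the index k with e' in E_a^k. *)
Definition internal_bound (GD : wgraph R N) (E2 : rel 'I_N) (eps : R)
    (k : 'I_m) : R :=
  (1 + eps^-1) *
  (\sum_(i < n0) \sum_(j < d k | edge GD (v0 i) (va j))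
      wt GD (v0 i) (va j) * Wkj GD j
   + 2 * \sum_(l < m)
      (\sum_(i < d k) \sum_(j < d l | E2 (va i) (va j))
          wt GD (va i) (va j) * Wkj GD i
       + \sum_(i < d l) \sum_(j < d k | E2 (va i) (va j))
          wt GD (va i) (va j) * Wkj GD j)).

End Disaggregation.

Arguments Pmx R {m} n0 d.
Arguments Dsmx R {m} n0 d.

(* Main.v *)
(** Let [Q y] denote the vector of averages of [y] over the sets [V_a^k]. By the
    fictitious space lemma, applied to the isometry [tP], whose adjoint satisfies
    [tP^T Ds y = Q y], it suffices that the energy of [Q y] on [G] is at most
    [1 + eps] times that of [y] on [G_D]. For an edge [(x, z)] of [G_D] between
    distinct clusters, [(Q y)_x - (Q y)_z] is [y_x - y_z] plus the deviations of
    [y] from its averages at [x] and [z]; Young's inequality with parameter [eps]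
    separates them, and the weights [W_k^j] bound the squared deviations by
    the unweighted energy inside the clusters, which the internal edges absorb. *)

From mathcomp Require Import boolp classical_sets reals spectral complex ring lra.
Require Import Defs.

Set Implicit Arguments.
Unset Strict Implicit.
Unset Printing Implicit Defensive.

Import Order.TTheory GRing.Theory Num.Theory.
Local Open Scope ring_scope.

(** * The Euclidean inner product and quadratic forms of symmetric matrices *)

Section Dot.
Variable R : realType.

Lemma dotE n (u v : 'cV[R]_n) : dot u v = \sum_i u i 0 * v i 0.
Proof. by rewrite /dot mxE; apply: eq_bigr => i _; rewrite mxE. Qed.

Lemma dotC n (u v : 'cV[R]_n) : dot u v = dot v u.
Proof. by rewrite !dotE; apply: eq_bigr => i _; rewrite mulrC. Qed.

Lemma dotDl n (u v w : 'cV[R]_n) : dot (u + v) w = dot u w + dot v w.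
Proof. by rewrite /dot linearD mulmxDl mxE. Qed.

Lemma dotZl n a (u w : 'cV[R]_n) : dot (a *: u) w = a * dot u w.
Proof. by rewrite /dot linearZ -scalemxAl mxE. Qed.

Lemma dotDr n (u v w : 'cV[R]_n) : dot u (v + w) = dot u v + dot u w.
Proof. by rewrite dotC dotDl !(dotC _ u). Qed.

Lemma dotZr n a (u w : 'cV[R]_n) : dot u (a *: w) = a * dot u w.
Proof. by rewrite dotC dotZl dotC. Qed.

Lemma dot0l n (u : 'cV[R]_n) : dot 0 u = 0.
Proof. by rewrite -[0](scale0r 0) dotZl mul0r. Qed.

Lemma dot_mulmxl m n (M : 'M[R]_(m, n)) u v :
  dot (M *m u) v = dot u (M^T *m v).
Proof. by rewrite /dot trmx_mul mulmxA. Qed.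

Lemma dot_ge0 n (u : 'cV[R]_n) : 0 <= dot u u.
Proof. by rewrite dotE sumr_ge0 // => i _; rewrite -expr2 sqr_ge0. Qed.

Lemma dot_eq0 n (u : 'cV[R]_n) : dot u u = 0 -> u = 0.
Proof.
rewrite dotE => /eqP; rewrite psumr_eq0 => [/allP u0|i _]; last first.
  by rewrite -expr2 sqr_ge0.
apply/colP=> i; rewrite mxE.
by have /implyP/(_ isT) := u0 i (mem_index_enum i); rewrite -expr2 sqrf_eq0 => /eqP.
Qed.

Lemma dot_gt0 n (u : 'cV[R]_n) : u != 0 -> 0 < dot u u.
Proof. by rewrite lt0r dot_ge0 andbT; apply: contraNN => /eqP/dot_eq0->. Qed.

(** The form is nonnegative at every combination of [u] and [v], and suitable coefficients give the
    inequality. As [M] is only semidefinite, [dot (M *m u) u = 0] is a separate case. *)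
Lemma psd_cauchy_schwarz n (M : 'M[R]_n) (u v : 'cV[R]_n) :
  M^T = M -> (forall x, 0 <= dot (M *m x) x) ->
  dot (M *m u) v ^+ 2 <= dot (M *m u) u * dot (M *m v) v.
Proof.
move=> symM psdM; set a := dot (M *m u) u; set b := dot (M *m u) v.
set c := dot (M *m v) v.
have symd x y : dot (M *m x) y = dot (M *m y) x.
  by rewrite dot_mulmxl symM dotC.
have quad s t : 0 <= s ^+ 2 * a + 2 * (s * t * b) + t ^+ 2 * c.
  apply: le_trans (psdM (s *: u + t *: v)) _.
  rewrite mulmxDr -!scalemxAr !(dotDl, dotDr, dotZl, dotZr) -/a -/b -/c.
  by rewrite (symd v u) -/b le_eqVlt; apply/orP; left; apply/eqP; ring.
have a0 : 0 <= a by exact: psdM.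
have [a1|] := ltrP 0 a; last first.
  move=> a2; have aE : a = 0 by apply/eqP; rewrite eq_le a2 a0.
  (* With [a = 0] these coefficients give [- (c + 2) * b ^+ 2 >= 0], which forces [b = 0]. *)
  have := quad (- (c + 1)) b.
  rewrite aE mulr0 add0r mul0r => h.
  have c0 : 0 <= c by exact: psdM.
  nra.
(* At these coefficients the form equals [a * (a * c - b ^+ 2)]. *)
have h := quad (- b) a.
have : 0 <= a * (a * c - b ^+ 2) by nra.
by rewrite pmulr_rge0 // subr_ge0.
Qed.

(** Polarization recovers every entry from values of the quadratic form. This later identifies the
    Laplacian of [G] from its energies alone. *)
Lemma sym_quadratic_inj n (M M' : 'M[R]_n) : M^T = M -> M'^T = M' ->
  (forall x, dot (M *m x) x = dot (M' *m x) x) -> M = M'.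
Proof.
move=> symM symM' eqM; apply/matrixP=> i j.
have entryE (K : 'M[R]_n) : K i j = dot (K *m delta_mx j 0) (delta_mx i 0).
  rewrite -colE dotE (bigD1 i) //= big1 ?addr0 => [|k ki].
    by rewrite !mxE !eqxx mulr1.
  by rewrite [delta_mx _ _ _ _]mxE (negbTE ki) mulr0.
rewrite !entryE; set x := delta_mx j 0; set y := delta_mx i 0.
have polar (K : 'M[R]_n) : K^T = K ->
    dot (K *m (x + y)) (x + y)
    = dot (K *m x) x + dot (K *m y) y + 2 * dot (K *m x) y.
  move=> symK; rewrite mulmxDr !(dotDl, dotDr).
  by rewrite [dot (K *m y) x]dot_mulmxl symK [dot y _]dotC; ring.
have := eqM (x + y); rewrite !polar // !eqM => /addrI.
exact: (mulfI (lt0r_neq0 (ltr0Sn R 1))).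
Qed.

End Dot.

(** * Simultaneous diagonalization of a Hermitian pencil *)

Section HermitianPencil.
Variable C : numClosedFieldType.
Local Notation "M ^t*" := (map_mx Num.conj M^T) (at level 30).

Lemma adjmxM m n p (M : 'M[C]_(m, n)) (N : 'M[C]_(n, p)) :
  (M *m N)^t* = N^t* *m M^t*.
Proof. by rewrite trmx_mul map_mxM. Qed.

Lemma hermsymmx_adj n (M : 'M[C]_n) : M^t* = M -> M \is hermsymmx.
Proof. by move=> adjM; apply/is_hermitianmxP; rewrite expr0 scale1r adjM. Qed.

Lemma adj_hermsymmx n (M : 'M[C]_n) : M \is hermsymmx -> M^t* = M.
Proof. by move/is_hermitianmxP; rewrite expr0 scale1r. Qed.

Lemma row_unitmx_neq0 (F : fieldType) n (U : 'M[F]_n) i :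
  U \in unitmx -> row i U != 0.
Proof.
move=> /mulmxV /matrixP/(_ i i); apply: contra_eq_neq => Ui.
rewrite !mxE eqxx big1 => [|j _]; first by rewrite eq_sym oner_eq0.
by have /rowP/(_ j) := Ui; rewrite !mxE => ->; rewrite mul0r.
Qed.

Lemma eigenvalue_spectral_diag n (M : 'M[C]_n) i :
  M \is hermsymmx -> eigenvalue M (spectral_diag M 0 i).
Proof.
move=> /hermitian_normalmx/orthomx_spectralP ME.
have unitU : spectralmx M \in unitmx by exact: spectral_unit.
apply/eigenvalueP; exists (row i (spectralmx M)); last exact: row_unitmx_neq0.
rewrite {2}ME -row_mul !mulmxA mulmxV // mul1mx.
by apply/rowP => j; rewrite mul_diag_mx !mxE.
Qed.

(** A square root of the spectrum of [B] gives [B = S *m S^t*]. If the unitary [V] diagonalizes the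
    Hermitian matrix [S^t* *m A *m S], then [F = S *m V^t*] works for both matrices. *)
Lemma hermitian_pencil_spectral n (B A : 'M[C]_n) :
  B \is hermsymmx -> (forall i, 0 < spectral_diag B 0 i) -> A \is hermsymmx ->
  exists (F : 'M[C]_n) (l : 'rV[C]_n),
  [/\ F \in unitmx, (forall i, l 0 i \is Num.real), B = F *m F^t*
    & A = (invmx F)^t* *m diag_mx l *m invmx F].
Proof.
move=> hermB b_gt0 hermA; set U := spectralmx B; set b := spectral_diag B.
have unitaryU : U \is unitarymx by exact: spectral_unitarymx.
have BE : B = U^t* *m diag_mx b *m U.
  rewrite -(invmx_unitary unitaryU).
  exact/orthomx_spectralP/hermitian_normalmx.
pose D := diag_mx (map_mx sqrtC b).
have DD : D *m D = diag_mx b.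
  rewrite /D mulmx_diag; congr diag_mx; apply/rowP => i.
  by rewrite !mxE -expr2 sqrtCK.
have unitD : D \in unitmx.
  rewrite unitmxE det_diag unitfE; apply/prodf_neq0 => i _.
  by rewrite mxE sqrtC_eq0 gt_eqF.
have adjD : D^t* = D.
  rewrite /D tr_diag_mx map_diag_mx; congr diag_mx; apply/rowP=> i; rewrite !mxE.
  by apply/CrealP/ger0_real; rewrite sqrtC_ge0 ltW.
have [S unitS BS] : exists2 S, S \in unitmx & B = S *m S^t*.
  exists (U^t* *m D).
    by rewrite unitmx_mul unitD unitarymx_unit // trmxC_unitary.
  by rewrite adjmxM adjD trmxCK mulmxA -[_ *m D *m D]mulmxA DD.
have herm : S^t* *m A *m S \is hermsymmx.
  by apply: hermsymmx_adj; rewrite !adjmxM trmxCK (adj_hermsymmx hermA) mulmxA.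
have /orthomx_spectralP := hermitian_normalmx herm.
set V := spectralmx _; set l := spectral_diag _ => AE.
have unitaryV : V \is unitarymx by exact: spectral_unitarymx.
have VV : V^t* *m V = 1%:M.
  by rewrite -invmx_unitary // mulVmx // unitarymx_unit.
have iE : invmx (S *m V^t*) = V *m invmx S.
  have e : (V *m invmx S) *m (S *m V^t*) = 1%:M.
    rewrite mulmxA mulmxKV //; exact/unitarymxP.
  by rewrite -[RHS]mulmx1 -(mulmxV (mulmx1_unit e).2) mulmxA e mul1mx.
exists (S *m V^t*), l; split.
- by rewrite unitmx_mul unitS unitarymx_unit // trmxC_unitary.
- by move=> i; apply: (mxOverP (hermitian_spectral_diag_real herm)).
- by rewrite BS adjmxM trmxCK mulmxA -[_ *m _ *m V]mulmxA VV mulmx1.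
- rewrite invmx_unitary // in AE.
  rewrite iE adjmxM mulmxA -[_ *m V^t* *m _]mulmxA -[_ *m _ *m V]mulmxA -AE.
  rewrite !mulmxA mulmxK // -adjmxM.
  by rewrite mulmxV // trmx1 map_mx1 mul1mx.
Qed.

End HermitianPencil.

(** * Real pencils: the spectrum of [B *m A] and bounds on Rayleigh quotients *)

Section Spectral.
Variable R : realType.
Local Notation C := R[i].
Local Notation toC := (real_complex R).
Local Notation cmx M := (map_mx toC M).
Local Notation "M ^t*" := (map_mx Num.conj M^T) (at level 30).

Lemma conj_real_complex (x : R) : Num.conj (toC x) = toC x.
Proof. by apply/CrealP; rewrite complex_real. Qed.

Lemma adj_cmx m n (M : 'M[R]_(m, n)) : (cmx M)^t* = cmx M^T.
Proof. by apply/matrixP=> i j; rewrite !mxE conj_real_complex. Qed.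

(** In the coordinates [t = H x] the form is the sum of the [g_i |t_i|^2]. A diagonalization over
    [R[i]] thus yields an inequality over [R]. *)
Lemma dot_ge0_diag n (M : 'M[R]_n) (H : 'M[C]_n) (g : 'rV[R]_n) :
  cmx M = H^t* *m diag_mx (cmx g) *m H -> (forall i, 0 <= g 0 i) ->
  forall x, 0 <= dot (M *m x) x.
Proof.
move=> MH g_ge0 x; rewrite -ler0c.
set t := H *m cmx x.
have -> : toC (dot (M *m x) x) = (t^t* *m diag_mx (cmx g) *m t) 0 0.
  have -> : toC (dot (M *m x) x) = (cmx (x^T *m M *m x)) 0 0.
    by rewrite dotC /dot mulmxA !mxE.
  by rewrite !map_mxM /= MH /t adjmxM adj_cmx !mulmxA.
rewrite mul_mx_diag mxE sumr_ge0 // => i _.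
rewrite !mxE mulrAC mulr_ge0 ?ler0c // mulrC -normCK.
exact: exprn_ge0.
Qed.

Lemma pencil_spectral n (B A : 'M[R]_n) : spd B -> A^T = A ->
  exists (F : 'M[C]_n) (l : 'rV[R]_n),
  [/\ F \in unitmx, cmx B = F *m F^t*
    & cmx A = (invmx F)^t* *m diag_mx (cmx l) *m invmx F].
Proof.
move=> [symB posB] symA.
have herm (M : 'M[R]_n) : M^T = M -> cmx M \is hermsymmx.
  by move=> symM; apply: hermsymmx_adj; rewrite adj_cmx symM.
have b_gt0 i : 0 < spectral_diag (cmx B) 0 i.
  have /mxOverP/(_ 0 i)/RRe_real <- := hermitian_spectral_diag_real (herm B symB).
  rewrite ltcR; set b := complex.Re _.
  (* A real eigenvalue of the embedded matrix is an eigenvalue of [B] over [R], so it has a real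
     eigenvector, on which the definiteness of [B] can be tested. *)
  have /eigenvalueP [v vB v0] : eigenvalue B b.
    rewrite -(eigenvalue_map toC) /= RRe_real.
      exact/eigenvalue_spectral_diag/herm.
    exact: (mxOverP (hermitian_spectral_diag_real (herm B symB))).
  have vT0 : v^T != 0 by rewrite trmx_eq0.
  have := posB _ vT0; rewrite -{1}symB -trmx_mul vB linearZ dotZl.
  by rewrite pmulr_lgt0 // dot_gt0.
have [F [l [unitF l_real BE AE]]] :=
  hermitian_pencil_spectral (herm B symB) b_gt0 (herm A symA).
pose l' := map_mx (@complex.Re R) l.
have lE : l = cmx l' by apply/rowP=> i; rewrite !mxE RRe_real.
by exists F, l'; rewrite -lE.
Qed.
(** The transpose [w] of a row eigenvector of [B *m A] is a column eigenvector of [A *m B], so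
    [B *m w] is a column eigenvector of [B *m A]. *)
Lemma spd_trmx_eigenvector n (B A : 'M[R]_n) a :
  spd B -> A^T = A -> eigenvalue (B *m A) a ->
  exists2 w : 'cV[R]_n, 0 < dot (B *m w) w & A *m (B *m w) = a *: w.
Proof.
move=> [symB posB] symA /eigenvalueP[v vBA v0]; exists v^T.
  by apply: posB; rewrite trmx_eq0.
by rewrite -{1}symA -{1}symB -!trmx_mul -mulmxA vBA linearZ.
Qed.

(** With [F] from the pencil, [B *m A] is similar to [diag_mx l]. The two inequalities say that
    [c B - B A B] and [A B A - c A] are semidefinite; [F] brings them to diagonal form with entries
    [c - l_i] and [l_i^2 - c l_i]. *)
Lemma spd_psd_rayleigh n (B A : 'M[R]_n) :
  spd B -> A^T = A -> (forall x, 0 <= dot (A *m x) x) ->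
  exists l : 'rV[R]_n,
  [/\ forall i, 0 <= l 0 i,
      forall a, eigenvalue (B *m A) a <-> exists i, l 0 i = a,
      forall c, (forall i, l 0 i <= c) ->
        forall s, dot (A *m (B *m s)) (B *m s) <= c * dot (B *m s) s
    & forall c, (forall i, l 0 i != 0 -> c <= l 0 i) ->
        forall s, c * dot (A *m s) s <= dot (B *m (A *m s)) (A *m s)].
Proof.
move=> spdB symA psdA.
have [F [l [unitF BE AE]]] := pencil_spectral spdB symA.
have KF : invmx F *m F = 1%:M by rewrite mulVmx.
have FKa : F^t* *m (invmx F)^t* = 1%:M.
  by rewrite -adjmxM KF trmx1 map_mx1.
have BAE : cmx (B *m A) = F *m diag_mx (cmx l) *m invmx F.
  by rewrite map_mxM /= BE AE !mulmxA -[_ *m F^t* *m _]mulmxA FKa mulmx1.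
have eigE a : eigenvalue (B *m A) a <-> exists i, l 0 i = a.
  rewrite -(eigenvalue_map toC) /= BAE; split=> [/eigenvalueP[v vE v0]|[i <-]].
    have vF0 : v *m F != 0 by rewrite mulmx_free_eq0 // row_free_unit.
    have [i vFi] : exists i, (v *m F) 0 i != 0.
      apply/existsP; apply: contraNT vF0 => /existsPn h.
      by apply/eqP/rowP=> i; rewrite [RHS]mxE; apply/eqP/negbNE/h.
    exists i; apply: complexI; apply: (mulfI vFi).
    have : v *m F *m diag_mx (cmx l) = toC a *: (v *m F).
      by rewrite scalemxAl -vE !mulmxA mulmxKV.
    move=> /rowP/(_ i); rewrite mul_mx_diag !mxE => e.
    by rewrite [RHS]mulrC -e.
  apply/eigenvalueP; exists (row i (invmx F)).
    rewrite -row_mul !mulmxA KF mul1mx.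
    by apply/rowP => j; rewrite mul_diag_mx !mxE.
  by rewrite row_unitmx_neq0 // unitmx_inv.
have l_ge0 i : 0 <= l 0 i.
  have /(spd_trmx_eigenvector spdB symA)[w Bw ABw] : eigenvalue (B *m A) (l 0 i).
    by apply/eigE; exists i.
  by have := psdA (B *m w); rewrite ABw dotZl dotC pmulr_lge0.
have symB := spdB.1.
exists l; split=> // c cP s.
- rewrite -subr_ge0.
  pose g : 'rV[R]_n := \row_i (c - l 0 i).
  have gE : diag_mx (cmx g) = toC c *: 1%:M - diag_mx (cmx l).
    apply/matrixP => i j; rewrite !mxE.
    by case: eqP => [->|_]; rewrite ?mulr1n ?mulr0n ?mulr1 ?mulr0 ?rmorphB ?subr0.
  have : cmx (c *: B - B *m A *m B) = (F^t*)^t* *m diag_mx (cmx g) *m F^t*.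
    rewrite map_mxB map_mxZ map_mxM BAE /= BE trmxCK gE mulmxBr mulmxBl.
    rewrite -scalemxAr -scalemxAl mulmx1; congr (_ - _).
    by rewrite !mulmxA mulmxKV.
  move=> /dot_ge0_diag h; apply: le_trans (h _ s) _.
    by move=> i; rewrite mxE subr_ge0.
  rewrite mulmxBl -scalemxAl -scaleN1r dotDl !dotZl mulN1r.
  by rewrite -!mulmxA [dot (B *m (A *m _)) s]dot_mulmxl symB.
- rewrite -subr_ge0.
  pose g : 'rV[R]_n := \row_i (l 0 i ^+ 2 - c * l 0 i).
  have gE : diag_mx (cmx g) = diag_mx (cmx l) *m diag_mx (cmx l)
      - toC c *: diag_mx (cmx l).
    rewrite mulmx_diag; apply/matrixP => i j; rewrite !mxE.
    case: eqP => [->|_]; rewrite ?mulr1n ?mulr0n ?mulr0 ?subr0 //.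
    by rewrite rmorphB !rmorphM.
  have : cmx (A *m B *m A - c *: A)
         = (invmx F)^t* *m diag_mx (cmx g) *m invmx F.
    rewrite map_mxB map_mxZ -[A *m B *m A]mulmxA map_mxM BAE /=.
    rewrite AE gE mulmxBr mulmxBl -scalemxAr -scalemxAl; congr (_ - _).
    by rewrite !mulmxA mulmxKV.
  move=> /dot_ge0_diag h; apply: le_trans (h _ s) _.
    move=> i; rewrite mxE subr_ge0 expr2.
    (* Where [l_i = 0] the diagonal entry vanishes, so [c] has to lie below the nonzero [l_i]
       only. *)
    have [->|li0] := eqVneq (l 0 i) 0; first by rewrite !mulr0.
    by apply: ler_wpM2r => //; apply: cP.
  rewrite mulmxBl -scalemxAl -[- (c *: _)]scaleN1r dotDl !dotZl mulN1r.
  by rewrite -!mulmxA [dot (A *m (B *m _)) s]dot_mulmxl symA.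
Qed.
End Spectral.

(** * The fictitious space lemma for an isometry [Pi] *)

Section FictitiousSpace.
Variables (R : realType) (n N : nat).
Variables (Bt At : 'M[R]_N) (Pi : 'M[R]_(N, n)) (c : R).
Hypothesis spdBt : spd Bt.
Hypothesis symAt : At^T = At.
Hypothesis psdAt : forall x, 0 <= dot (At *m x) x.
Hypothesis PiK : Pi^T *m Pi = 1%:M.
Let A := Pi^T *m At *m Pi.
Let B := Pi^T *m Bt *m Pi.
Hypothesis c_gt0 : 0 < c.
Hypothesis bounded :
  forall v, dot (A *m (Pi^T *m v)) (Pi^T *m v) <= c * dot (At *m v) v.

Lemma dot_congr (M : 'M[R]_N) x y :
  dot (Pi^T *m M *m Pi *m x) y = dot (M *m (Pi *m x)) (Pi *m y).
Proof. by rewrite -!mulmxA dot_mulmxl trmxK. Qed.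

Lemma sym_congr (M : 'M[R]_N) : M^T = M -> (Pi^T *m M *m Pi)^T = Pi^T *m M *m Pi.
Proof. by move=> symM; rewrite !trmx_mul trmxK symM mulmxA. Qed.

Lemma spd_congr : spd B.
Proof.
split=> [|x x0]; first exact: sym_congr spdBt.1.
rewrite dot_congr; apply: spdBt.2; apply: contraNneq x0 => Pix0.
by rewrite -[x]mul1mx -PiK -mulmxA Pix0 mulmx0.
Qed.

Lemma psd_congr x : 0 <= dot (A *m x) x.
Proof. by rewrite dot_congr. Qed.

Section Eigenvalue.
Variable a : R.
Hypothesis eigen_a : eigenvalue (B *m A) a.

(** The vector [v = Bt Pi w] is mapped by [Pi^T] to the eigenvector [B w]. At this [v], [bounded]
    reads [a <B w, w> <= c <At v, v>], and the right side is at most [c mx <B w, w>]. *)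
Lemma fictitious_eigen_le mx :
  (forall s, dot (At *m (Bt *m s)) (Bt *m s) <= mx * dot (Bt *m s) s) ->
  a <= c * mx.
Proof.
move=> mxP.
have [w Bw ABw] := spd_trmx_eigenvector spd_congr (sym_congr symAt) eigen_a.
have uE : Pi^T *m (Bt *m (Pi *m w)) = B *m w by rewrite !mulmxA.
have := bounded (Bt *m (Pi *m w)); rewrite uE -/A ABw dotZl dotC => h.
rewrite -(ler_pM2r Bw); apply: le_trans h _.
rewrite -mulrA ler_pM2l // [dot (B *m w) w]dot_congr; exact: mxP.
Qed.

(* [u = B w] is an eigenvector of [BA]. Since [Pi w] is orthogonal to the kernel
   of [At], it equals [At s], and Cauchy-Schwarz for [At] applied to
   [<w, u> = <At s, Pi u>] compares the two quotients. *)
Lemma fictitious_eigen_ge mn : 0 < mn -> a != 0 ->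
  (forall s, mn * dot (At *m s) s <= dot (Bt *m (At *m s)) (At *m s)) ->
  mn <= a.
Proof.
move=> mn0 a0 mnP.
have [w] := spd_trmx_eigenvector spd_congr (sym_congr symAt) eigen_a.
rewrite -/A; set u := B *m w => Bw ABw.
(* For [k] in the kernel of [At], [bounded] makes the [A]-energy of [Pi^T k] vanish, and
   Cauchy-Schwarz for [A] kills [<A u, Pi^T k> = a <Pi w, k>]. *)
have orth k : At *m k = 0 -> dot (Pi *m w) k = 0.
  move=> Atk; apply: (mulfI a0); rewrite mulr0.
  have -> : a * dot (Pi *m w) k = dot (A *m u) (Pi^T *m k).
    by rewrite ABw dotZl dot_mulmxl.
  have := psd_cauchy_schwarz u (Pi^T *m k) (sym_congr symAt) psd_congr.
  have -> : dot (Pi^T *m At *m Pi *m (Pi^T *m k)) (Pi^T *m k) = 0.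
    apply/eqP; rewrite eq_le psd_congr andbT.
    by apply: le_trans (bounded k) _; rewrite Atk dot0l mulr0.
  rewrite mulr0 => h; apply/eqP; rewrite -sqrf_eq0 eq_le h; exact: sqr_ge0.
(* The columns of [cokermx At] lie in the kernel of [At], and a row orthogonal to all of them lies
   in the row space of [At]. *)
have [s sE] : exists s, Pi *m w = At *m s.
  have /submxP[D DE] : ((Pi *m w)^T <= At)%MS.
    rewrite submxE; apply/eqP/rowP=> j; rewrite [RHS]mxE.
    transitivity (dot (Pi *m w) (cokermx At *m delta_mx j 0)).
      rewrite -colE dotE [LHS]mxE; apply: eq_bigr => i _.
      by rewrite [_^T _ _]mxE [col _ _ _ _]mxE.
    by apply: orth; rewrite (mulmxA At) mulmx_coker mul0mx.
  by exists D^T; rewrite -[LHS]trmxK DE trmx_mul symAt.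
have wu : dot u w = dot (At *m s) (Pi *m u).
  by rewrite -sE dot_mulmxl mulmxA PiK mul1mx dotC.
have := psd_cauchy_schwarz s (Pi *m u) symAt psdAt; rewrite -wu.
rewrite -[dot (At *m (Pi *m u)) _]dot_congr -/A ABw dotZl [dot w u]dotC => h1.
have := mnP s; rewrite -sE -[dot _ (Pi *m w)]dot_congr -/B -/u => h2.
move: h1 h2 Bw; rewrite -sE.
set x := dot _ s; set y := dot u w => h1 h2 y0.
(* Here [h1] is [y^2 <= x a y] and [h2] is [mn x <= y]; cancelling [y] and then [x] leaves
   [mn <= a]. *)
have h3 : y <= x * a by rewrite -(ler_pM2r y0) -expr2 -mulrA.
have x0 : 0 < x.
  rewrite lt0r /x sE psdAt andbT -sE -/x; apply/eqP => x0.
  by move: h3; rewrite x0 mul0r leNgt y0.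
by rewrite -(ler_pM2r x0) (le_trans h2) // mulrC.
Qed.

End Eigenvalue.

(** The eigenvalue bounds compare the suprema up to the factor [c], and the infima without loss.
    Since [sup] and [inf] of the empty set are 0, empty sets are treated apart. *)
Lemma fictitious_space : cond_number (B *m A) <= c * cond_number (Bt *m At).
Proof.
have [l [l_ge0 eigE leP geP]] := spd_psd_rayleigh spdBt symAt psdAt.
have [l' [l'_ge0 eigE' _ _]] :=
  spd_psd_rayleigh spd_congr (sym_congr symAt) psd_congr.
rewrite /cond_number; set S2 := [set a | eigenvalue (Bt *m At) a]%classic.
set T2 := [set a | eigenvalue (Bt *m At) a /\ a != 0]%classic.
set S1 := [set a | eigenvalue (B *m A) a]%classic.
set T1 := [set a | eigenvalue (B *m A) a /\ a != 0]%classic.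
have S2bound : has_ubound S2.
  exists (\sum_i l 0 i) => a /eigE[i <-].
  by rewrite (bigD1 i) //= lerDl sumr_ge0.
have l_sup i : l 0 i <= sup S2.
  by apply: ub_le_sup S2bound _ _; apply/eigE; exists i.
have sup2_ge0 : 0 <= sup S2.
  have [->|/set0P[a aS]] := eqVneq S2 set0; first by rewrite sup0.
  by have /eigE[i ai] := aS; rewrite (le_trans (l_ge0 i)) // l_sup.
have inf_ge0 (T : set R) : (forall a, T a -> 0 <= a) -> 0 <= inf T.
  by have [->|/set0P Tn Tge0] := eqVneq T set0; [rewrite inf0|exact: lb_le_inf].
have T2ge0 a : T2 a -> 0 <= a by move=> [/eigE[i <-]].
have sup1 : sup S1 <= c * sup S2.
  have [->|/set0P S1n] := eqVneq S1 set0; first by rewrite sup0 mulr_ge0 // ltW.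
  by apply: ge_sup => // a aS; apply: (fictitious_eigen_le aS); apply: leP.
(* If [B *m A] has no nonzero eigenvalue, the infimum is 0, its inverse is 0, and so is the left
   side. *)
have [->|/set0P T1n] := eqVneq T1 set0.
  by rewrite inf0 invr0 mulr0 mulr_ge0 // ?divr_ge0 ?inf_ge0 // ltW.
(* Otherwise the lower Rayleigh bound would hold vacuously with any constant, and [|a0| + 1] would
   bound the eigenvalue [a0] from below. *)
have T2n : nonempty T2.
  apply: contrapT => T2_0; have [a0 [a0E a00]] := T1n.
  have := @fictitious_eigen_ge a0 a0E (`|a0| + 1) _ a00.
  have := ler_norm a0 => a0_le h; suff : `|a0| + 1 <= a0 by lra.
  apply: h; first by rewrite ltr_wpDl.
  apply: geP => i li0; exfalso; apply: T2_0; exists (l 0 i).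
  by split=> //; apply/eigE; exists i.
have inf2_gt0 : 0 < inf T2.
  (* The default value 1 keeps this lower bound for [T2] positive. *)
  pose m0 := \big[Order.min/1]_(i | l 0 i != 0) l 0 i.
  have m0_gt0 : 0 < m0.
    rewrite /m0; elim/big_ind: _ => // [x y x0 y0|i li0].
      by rewrite lt_min x0 y0.
    by rewrite lt0r li0 l_ge0.
  apply: (lt_le_trans m0_gt0); apply: lb_le_inf => // a [/eigE[i <-] li0].
  exact: bigmin_le_cond.
have inf1 : inf T2 <= inf T1.
  apply: lb_le_inf => // a [aE a0].
  apply: (fictitious_eigen_ge aE) => //; apply: geP => i li0.
  apply: ge_inf; last by split=> //; apply/eigE; exists i.
  by exists 0 => b; exact: T2ge0.
rewrite mulrA; apply: le_trans (_ : c * sup S2 / inf T1 <= _).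
  by rewrite ler_pM2r // invr_gt0 (lt_le_trans inf2_gt0).
apply: ler_wpM2l; first by rewrite mulr_ge0 // ltW.
by rewrite lef_pV2 // posrE (lt_le_trans inf2_gt0).
Qed.
End FictitiousSpace.

(** * Laplacian energies and the deviation from the mean *)

Section LaplacianForm.
Variables (R : realType) (n : nat).
Implicit Types (G : wgraph R n) (u v : 'cV[R]_n).

Lemma laplacian_formC G u v : laplacian_form G u v = laplacian_form G v u.
Proof. by apply: eq_bigr => i _; apply: eq_bigr => j _; rewrite mulrAC. Qed.

Lemma tr_laplacian G : (laplacian G)^T = laplacian G.
Proof. by apply/matrixP=> i j; rewrite !mxE laplacian_formC. Qed.

Lemma laplacian_form_ge0 G u : 0 <= laplacian_form G u u.
Proof.
apply: sumr_ge0 => i _; apply: sumr_ge0 => j _.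
by rewrite -mulrA mulr_ge0 ?wt_ge0 // -expr2 sqr_ge0.
Qed.

Lemma laplacian_psd G u : 0 <= dot (laplacian G *m u) u.
Proof. by rewrite laplacianP laplacian_form_ge0. Qed.

Lemma laplacian_form_const G u a : laplacian_form G u (const_mx a) = 0.
Proof.
by apply: big1 => i _; apply: big1 => j _; rewrite !mxE subrr mulr0.
Qed.

(** Ordered pairs count each edge twice, and non-edges have weight 0. The symmetric sum has no order
    condition and can be regrouped by clusters. *)
Lemma laplacian_form_sum G u :
  2 * laplacian_form G u u = \sum_i \sum_j wt G i j * (u i 0 - u j 0) ^+ 2.
Proof.
pose f i j := wt G i j * (u i 0 - u j 0) ^+ 2.
have fC i j : f i j = f j i by rewrite /f wt_sym -sqrrN opprB.
have formE : laplacian_form G u u = \sum_(i < n) \sum_(j < n | (i < j)%N) f i j.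
  apply: eq_bigr => i _; rewrite [RHS](bigID (edge G i)) /=.
  rewrite [X in _ = _ + X]big1 ?addr0 => [|j /andP[_]]; last first.
    by rewrite /edge -leNgt /f => w0; have/eqP-> : wt G i j == 0;
      [rewrite eq_le w0 wt_ge0 | rewrite mul0r].
  by apply: eq_bigr => j _; rewrite /f expr2 mulrA.
transitivity (\sum_(i < n) (\sum_(j < n | (i < j)%N) f i j
                             + \sum_(j < n | (j < i)%N) f i j)).
  rewrite big_split /= [X in _ = _ + X](exchange_big_dep predT) //= mulr_natl mulr2n.
  by rewrite formE; congr (_ + _); apply: eq_bigr => i _; apply: eq_bigr.
apply: eq_bigr => i _; rewrite [RHS](bigID (fun j : 'I_n => (i < j)%N)) /=.
congr (_ + _); rewrite [RHS](bigD1 i) ?ltnn //= subrr expr0n mulr0 add0r.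
by apply: eq_bigl => j; rewrite -leqNgt ltn_neqAle andbC.
Qed.

(** All terms of the energy are nonnegative, so each vanishes; [u] is then constant along edges,
    hence along paths. *)
Lemma laplacian_form_eq0 G u : (forall x y, connect (edge G) x y) ->
  laplacian_form G u u = 0 -> forall x y, u x 0 = u y 0.
Proof.
move=> cG form0.
have : \sum_i \sum_j wt G i j * (u i 0 - u j 0) ^+ 2 = 0.
  by rewrite -laplacian_form_sum form0 mulr0.
have t_ge0 i j : 0 <= wt G i j * (u i 0 - u j 0) ^+ 2.
  by rewrite mulr_ge0 ?wt_ge0 ?sqr_ge0.
move=> /psumr_eq0P sum0 x y.
have step i j : edge G i j -> u i 0 = u j 0.
  move=> eij; have /psumr_eq0P/(_ j isT)/eqP : \sum_j wt G i j * (u i 0 - u j 0) ^+ 2 = 0.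
    by apply: sum0 => // k _; apply: sumr_ge0.
  rewrite mulf_eq0 gt_eqF //= sqrf_eq0 subr_eq0 => /(_ _)/eqP; exact.
have /connectP[p pp ->] := cG x y.
elim: p x pp => //= z p IHp x /andP[/step-> pz]; exact: IHp.
Qed.

Lemma dot_delta_mx j u v : dot (delta_mx j j *m u) v = u j 0 * v j 0.
Proof.
rewrite dotE (bigD1 j) //= big1 ?addr0 => [|i ij].
  rewrite mxE (bigD1 j) //= big1 ?addr0 => [|k kj].
    by rewrite !mxE !eqxx mul1r.
  by rewrite !mxE (negbTE kj) andbF mul0r.
by rewrite mxE big1 ?mul0r // => k _; rewrite !mxE (negbTE ij) mul0r.
Qed.

(** A kernel vector has zero energy and vanishes at [j]; connectedness makes it constant, hence
    zero. *)
Lemma laplacian_rank1_unit G j : (forall x y, connect (edge G) x y) ->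
  laplacian G + delta_mx j j \in unitmx.
Proof.
move=> cG; rewrite -row_free_unit; apply: inj_row_free => v vL.
pose x := v^T.
have Lx : laplacian G *m x + delta_mx j j *m x = 0.
  rewrite -mulmxDl -[laplacian G]tr_laplacian -[delta_mx j j]trmxK.
  by rewrite trmx_delta -linearD -trmx_mul vL trmx0.
have := dot0l x; rewrite -Lx dotDl laplacianP dot_delta_mx -expr2 => e.
have f0 := laplacian_form_ge0 G x; have s0 := sqr_ge0 (x j 0).
have form0 : laplacian_form G x x = 0 by lra.
have /eqP : x j 0 ^+ 2 = 0 by lra.
rewrite sqrf_eq0 => /eqP xj.
apply/rowP=> i; rewrite [RHS]mxE -xj -(laplacian_form_eq0 cG form0 i j).
by rewrite mxE.
Qed.

(* With [L_j = L + e_j e_j^T] and [z = L_j^-1 1], the identity [1^T L = 0] gives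
   [z_j = n], so that [1^T y = z^T L_j y = z^T L y + n y_j]. *)
Lemma mean_deviation G j (y : 'cV[R]_n) : (forall x y, connect (edge G) x y) ->
  (y j 0 - (\sum_i y i 0) / n%:R) ^+ 2 <=
  (n%:R ^+ 2)^-1 *
  sqnorm (laplacian G)
    (invmx (laplacian G + delta_mx j j) *m (const_mx 1 : 'cV[R]_n))
  * laplacian_form G y y.
Proof.
move=> cG; set L := laplacian G; set z := invmx _ *m _.
have n0 : n%:R != 0 :> R by rewrite pnatr_eq0 -lt0n (leq_ltn_trans _ (ltn_ord j)).
have Lz : L *m z + delta_mx j j *m z = const_mx 1.
  by rewrite -mulmxDl /z mulKVmx // laplacian_rank1_unit.
have sumE (x : 'cV[R]_n) : dot (const_mx 1) x = \sum_i x i 0.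
  by rewrite dotE; apply: eq_bigr => i _; rewrite mxE mul1r.
have zj : z j 0 = n%:R.
  have : dot (L *m z + delta_mx j j *m z) (const_mx 1) = n%:R.
    rewrite Lz sumE; under eq_bigr do rewrite mxE.
    by rewrite sumr_const card_ord.
  rewrite dotDl laplacianP laplacian_form_const dot_delta_mx.
  by rewrite [const_mx _ _ _]mxE mulr1 add0r.
have meanE : y j 0 - (\sum_i y i 0) / n%:R = - (dot (L *m z) y / n%:R).
  by rewrite -sumE -Lz dotDl dot_delta_mx zj mulrDl mulrAC mulfV // mul1r
    opprD addrCA subrr addr0.
(* With the deviation written as [- <L z, y> / n], Cauchy-Schwarz for [L] separates [z] from [y]. *)
rewrite meanE sqrrN expr_div_n -mulrA mulrC ler_wpM2l ?invr_ge0 ?sqr_ge0 //.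
rewrite -laplacianP; apply: psd_cauchy_schwarz; first exact: tr_laplacian.
exact: laplacian_psd.
Qed.

End LaplacianForm.

(** * Vertex clusters, averaging and the scaled prolongation *)

Section Vertices.
Variables (R : realType) (m n0 : nat) (d : 'I_m -> nat).
Local Notation N := (\sum_(k < m) d k + n0)%N.

Lemma parent_va k (p : 'I_(d k)) : parent (va n0 p) = lshift n0 k.
Proof. by rewrite /parent /va (unsplitK (inl _)) tagnat.Rank1K. Qed.

Lemma parent_v0 (i : 'I_n0) : parent (v0 d i) = rshift m i.
Proof. by rewrite /parent /v0 (unsplitK (inr _)). Qed.

Lemma vertex_ind (Q : 'I_N -> Prop) :
  (forall k (p : 'I_(d k)), Q (va n0 p)) -> (forall i, Q (v0 d i)) ->
  forall x, Q x.
Proof.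
move=> Qa Q0 x; rewrite -[x]splitK; case: (split x) => [p|i] /=; last exact: Q0.
by rewrite -[p]tagnat.sig2K; apply: Qa.
Qed.

Lemma sum_vertices (f : 'I_N -> R) (P : pred 'I_N) :
  \sum_(x | P x) f x
  = \sum_(k < m) \sum_(p < d k | P (va n0 p)) f (va n0 p)
    + \sum_(i < n0 | P (v0 d i)) f (v0 d i).
Proof.
rewrite big_split_ord /=; congr (_ + _).
rewrite (reindex _ (onW_bij _ tagnat.rank_bij)) sig_big_dep /=.
by apply: eq_big => [[k p]|[k p] _].
Qed.

(** The averaging operator [Q] of the overview. *)
Definition aggregate (y : 'cV[R]_N) : 'cV[R]_(m + n0) :=
  \col_u match split u with
         | inl k => (\sum_(p < d k) y (va n0 p) 0) / (d k)%:R
         | inr i => y (v0 d i) 0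
         end.

Lemma aggregate_lshift y k :
  aggregate y (lshift n0 k) 0 = (\sum_(p < d k) y (va n0 p) 0) / (d k)%:R.
Proof. by rewrite mxE (unsplitK (inl k)). Qed.

Lemma aggregate_rshift y i : aggregate y (rshift m i) 0 = y (v0 d i) 0.
Proof. by rewrite mxE (unsplitK (inr i)). Qed.

Definition Ds_row : 'rV[R]_N :=
  row_mx (\mxrow_k const_mx (Num.sqrt (d k)%:R)^-1) (const_mx 1).

Lemma Dsmx_diag : Dsmx R n0 d = diag_mx Ds_row.
Proof.
rewrite diag_mx_row diag_const_mx diag_mxrow; congr block_mx.
by apply: eq_mxdiag => k; rewrite diag_const_mx.
Qed.

Lemma Ds_row_va k (p : 'I_(d k)) : Ds_row 0 (va n0 p) = (Num.sqrt (d k)%:R)^-1.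
Proof. by rewrite row_mxEl !mxE tagnat.Rank1K. Qed.

Lemma Ds_row_v0 i : Ds_row 0 (v0 d i) = 1.
Proof. by rewrite row_mxEr mxE. Qed.

Lemma PmxE x u : Pmx R n0 d x u = (parent x == u)%:R.
Proof.
rewrite eq_sym; elim/vertex_ind: x => [k p|i];
  rewrite ?parent_va ?parent_v0 -[u]splitK; case: (split u) => [l|j] /=.
- by rewrite block_mxEul !mxE tagnat.Rank1K eq_lshift.
- by rewrite block_mxEur mxE eq_rlshift.
- by rewrite block_mxEdl mxE eq_lrshift.
- by rewrite block_mxEdr mxE eq_rshift eq_sym.
Qed.

Lemma Pmx_mulE (u : 'cV[R]_(m + n0)) x : (Pmx R n0 d *m u) x 0 = u (parent x) 0.
Proof.
rewrite mxE (bigD1 (parent x)) //= [X in _ + X]big1 ?addr0 => [|v vx].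
  by rewrite PmxE eqxx mul1r.
by rewrite PmxE eq_sym (negbTE vx) mul0r.
Qed.

Hypothesis d_gt0 : forall k, (0 < d k)%N.

Lemma Dsmx_unit : Dsmx R n0 d \in unitmx.
Proof.
rewrite Dsmx_diag unitmxE det_diag unitfE; apply/prodf_neq0 => x _.
elim/vertex_ind: x => [k p|i]; last by rewrite Ds_row_v0 oner_eq0.
by rewrite Ds_row_va invr_eq0 sqrtr_eq0 -ltNge ltr0n.
Qed.

Lemma tr_Dsmx : (Dsmx R n0 d)^T = Dsmx R n0 d.
Proof. by rewrite Dsmx_diag tr_diag_mx. Qed.

Lemma Dsmx_mulE (y : 'cV[R]_N) x : (Dsmx R n0 d *m y) x 0 = Ds_row 0 x * y x 0.
Proof. by rewrite Dsmx_diag mul_diag_mx mxE. Qed.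

(** [P^T] sums over each cluster, and the two scalings [d_k^(-1/2)], one from each [Ds], combine to
    [1 / d_k]. *)
Lemma aggregateE y :
  (Dsmx R n0 d *m Pmx R n0 d)^T *m (Dsmx R n0 d *m y) = aggregate y.
Proof.
rewrite trmx_mul tr_Dsmx -mulmxA; apply/colP=> u.
rewrite [LHS]mxE sum_vertices.
under eq_bigr => k _ do under eq_bigr => p _ do
  rewrite [_^T _ _]mxE PmxE parent_va !Dsmx_mulE Ds_row_va
    [_^-1 * (_ * _)]mulrA -expr2 exprVn sqr_sqrtr ?ler0n //.
under [X in _ + X]eq_bigr => i _ do
  rewrite [_^T _ _]mxE PmxE parent_v0 !Dsmx_mulE Ds_row_v0 !mul1r.
rewrite -[u]splitK; case: (split u) => [l|j] /=.
  rewrite aggregate_lshift [X in _ + X]big1 ?addr0 => [|i _]; last first.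
    by rewrite eq_rlshift mul0r.
  rewrite (bigD1 l) //= [X in _ + X]big1 ?addr0 => [|k kl]; last first.
    by apply: big1 => p _; rewrite eq_lshift (negbTE kl) mul0r.
  by rewrite mulr_suml; apply: eq_bigr => p _; rewrite eqxx mul1r mulrC.
rewrite aggregate_rshift big1 ?add0r => [|k _]; last first.
  by apply: big1 => p _; rewrite eq_lrshift mul0r.
rewrite (bigD1 j) //= [X in _ + X]big1 ?addr0 => [|i ij].
  by rewrite eqxx mul1r.
by rewrite eq_rshift (negbTE ij) mul0r.
Qed.

Lemma aggregate_Pmx u : aggregate (Pmx R n0 d *m u) = u.
Proof.
apply/colP=> v; rewrite -[v]splitK; case: (split v) => [k|i] /=.
  rewrite aggregate_lshift (eq_bigr (fun=> u (lshift n0 k) 0)) => [|p _];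
    last by rewrite Pmx_mulE parent_va.
  by rewrite sumr_const card_ord -[u _ _ *+ _]mulr_natr mulfK // pnatr_eq0 -lt0n.
by rewrite aggregate_rshift Pmx_mulE parent_v0.
Qed.

(** [P u] is constant on clusters, so averaging it returns [u]; by [aggregateE] this says that
    [Ds P] is an isometry. *)
Lemma scaled_Pmx_orthonormal :
  (Dsmx R n0 d *m Pmx R n0 d)^T *m (Dsmx R n0 d *m Pmx R n0 d) = 1%:M.
Proof.
apply/matrixP=> i j; set M := _ *m _.
have := aggregate_Pmx (delta_mx j 0); rewrite -aggregateE (mulmxA (Dsmx _ _ _)) mulmxA.
by move=> /colP/(_ i); rewrite -/M -colE [col _ _ _ _]mxE => ->;
  rewrite !mxE eqxx andbT.
Qed.

End Vertices.

(** * Energy of the averaged vector against the energy on the disaggregated graph *)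

Section Energy.
Variables (R : realType) (m n0 : nat) (d : 'I_m -> nat).
Local Notation N := (\sum_(k < m) d k + n0)%N.
Variables (G : wgraph R (m + n0)) (GD : wgraph R N) (E2 : rel 'I_N).
Hypothesis disag : is_disaggregation G GD.
Hypothesis oriented : is_oriented_E2 GD E2.
Implicit Types (x z : 'I_N) (y : 'cV[R]_N).

(** Ordered pairs are used, as in [laplacian_form_sum], so each edge between clusters counts twice;
    a vertex of [V^0] is a cluster of its own. *)
Definition cross_sum (f : 'I_N -> 'I_N -> R) : R :=
  \sum_x \sum_(z | parent x != parent z) wt GD x z * f x z.

(** Pairs are grouped by their parents [u] and [v]: for [u != v] only [(r u v, r v u)] can have
    nonzero weight, namely that of [G], and for [u = v] both sides are 0. *)
Lemma cross_sum_parent (g : 'I_(m + n0) -> 'I_(m + n0) -> R) :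
  cross_sum (fun x z => g (parent x) (parent z))
  = \sum_u \sum_v wt G u v * g u v.
Proof.
have [[r [rP wtE]] _] := disag.
rewrite /cross_sum (partition_big (@parent m n0 d) predT) //=.
apply: eq_bigr => u _.
transitivity (\sum_v \sum_(x | parent x == u)
  \sum_(z | (parent x != parent z) && (parent z == v))
    wt GD x z * g (parent x) (parent z)).
  rewrite exchange_big; apply: eq_bigr => x _.
  by rewrite (partition_big (@parent m n0 d) predT).
apply: eq_bigr => v _.
have [<-|uv] := eqVneq u v.
  rewrite wt_loopless mul0r; apply: big1 => x /eqP->; apply: big_pred0 => z.
  by rewrite eq_sym andbC; case: eqP.
rewrite (bigD1 (r u v)) ?rP //= [X in _ + X]big1 ?addr0 => [|x /andP[/eqP xu xr]].
  rewrite (bigD1 (r v u)) ?rP ?uv ?eqxx //= [X in _ + X]big1 ?addr0 => [|z].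
    by rewrite wtE ?rP // !eqxx.
  move=> /andP[/andP[uz /eqP zv] zr]; rewrite wtE ?rP // zv.
  by rewrite (negbTE zr) andbF mul0r.
apply: big1 => z /andP[xz /eqP zv]; rewrite wtE // xu zv.
by rewrite (negbTE xr) mul0r.
Qed.

Lemma cross_sum_le f g : (forall x z, f x z <= g x z) ->
  cross_sum f <= cross_sum g.
Proof.
move=> fg; apply: ler_sum => x _; apply: ler_sum => z _.
by rewrite ler_wpM2l ?wt_ge0.
Qed.

Lemma cross_sumD a b f g :
  cross_sum (fun x z => a * f x z + b * g x z)
  = a * cross_sum f + b * cross_sum g.
Proof.
rewrite !mulr_sumr -big_split; apply: eq_bigr => x _ /=.
rewrite !mulr_sumr -big_split; apply: eq_bigr => z _ /=; ring.
Qed.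

(** Exchanging [x] and [z] charges each edge end to its own vertex. *)
Lemma cross_sum_sym c (f : 'I_N -> R) : (forall x z, c x z = c z x) ->
  cross_sum (fun x z => c x z * (f x + f z))
  = 2 * cross_sum (fun x z => c x z * f x).
Proof.
move=> cC; transitivity (cross_sum (fun x z => 1 * (c x z * f x) + 1 * (c x z * f z))).
  by apply: eq_bigr => x _; apply: eq_bigr => z _; rewrite !mul1r mulrDr.
rewrite cross_sumD !mul1r mulr_natl mulr2n; congr (_ + _).
rewrite /cross_sum (exchange_big_dep predT) //=; apply: eq_bigr => x _.
by apply: eq_big => z; rewrite eq_sym // wt_sym cC.
Qed.

Definition restrict y k : 'cV[R]_(d k) := \col_p y (va n0 p) 0.

(** Distinct vertices of [V^0] have distinct parents, so the pairs with equal parents contribute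
    only inside the sets [V_a^k]. *)
Lemma laplacian_form_split y :
  2 * laplacian_form GD y y
  = cross_sum (fun x z => (y x 0 - y z 0) ^+ 2)
    + 2 * \sum_k laplacian_form (internal GD k) (restrict y k) (restrict y k).
Proof.
rewrite laplacian_form_sum mulr_sumr.
rewrite [X in _ = _ + X](eq_bigr _ (fun k _ => laplacian_form_sum _ _)).
rewrite /cross_sum.
transitivity (\sum_x
  (\sum_(z | parent x != parent z) wt GD x z * (y x 0 - y z 0) ^+ 2
   + \sum_(z | parent x == parent z) wt GD x z * (y x 0 - y z 0) ^+ 2)).
  by apply: eq_bigr => x _; rewrite addrC (bigID (fun z => parent x == parent z)).
rewrite big_split /=; congr (_ + _).
rewrite sum_vertices [X in _ + X]big1 ?addr0 => [|i _]; last first.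
  apply: big1; elim/vertex_ind => [l q|j].
    by rewrite parent_v0 parent_va eq_rlshift.
  by rewrite !parent_v0 eq_rshift => /eqP->; rewrite wt_loopless mul0r.
apply: eq_bigr => k _; apply: eq_bigr => p _.
rewrite sum_vertices [X in _ + X]big1 ?addr0 => [|i]; last first.
  by rewrite parent_v0 parent_va eq_lrshift.
rewrite (bigD1 k) //= [X in _ + X]big1 ?addr0 => [|l lk]; last first.
  by apply: big1 => q; rewrite !parent_va eq_lshift eq_sym (negbTE lk).
by apply: eq_big => q; [rewrite !parent_va eqxx | rewrite !mxE].
Qed.

(* Splitting [e_x - e_z] costs a factor 2 unless one endpoint lies in [V^0],
   where the deviation [e] vanishes. *)
Definition split_cost x z : R :=
  match split x, split z with inl _, inl _ => 2 | _, _ => 1 end.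

Lemma split_cost_va k l (p : 'I_(d k)) (q : 'I_(d l)) :
  split_cost (va n0 p) (va n0 q) = 2.
Proof. by rewrite /split_cost !(unsplitK (inl _)). Qed.

Lemma split_cost_v0l i x : split_cost (v0 d i) x = 1.
Proof. by rewrite /split_cost (unsplitK (inr _)). Qed.

Lemma split_costC x z : split_cost x z = split_cost z x.
Proof. by rewrite /split_cost; case: (split x); case: (split z). Qed.

Lemma split_cost_ge0 x z : 0 <= split_cost x z.
Proof. by rewrite /split_cost; case: (split x) => _ //; case: (split z). Qed.

Definition deviation y x : R := y x 0 - aggregate y (parent x) 0.

Lemma deviation_v0 y i : deviation y (v0 d i) = 0.
Proof. by rewrite /deviation parent_v0 aggregate_rshift subrr. Qed.

(** If one endpoint lies in [V^0], its deviation is 0 and equality holds; otherwise the difference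
    of the two sides is a square. *)
Lemma deviation_split y x z :
  (deviation y x - deviation y z) ^+ 2
  <= split_cost x z * (deviation y x ^+ 2 + deviation y z ^+ 2).
Proof.
elim/vertex_ind: x => [k p|i]; last first.
  by rewrite split_cost_v0l deviation_v0 sub0r sqrrN expr0n add0r mul1r.
elim/vertex_ind: z => [l q|i]; last first.
  by rewrite split_costC split_cost_v0l deviation_v0 subr0 expr0n addr0 mul1r.
rewrite split_cost_va -subr_ge0; set a := deviation _ _; set b := deviation _ _.
have -> : 2 * (a ^+ 2 + b ^+ 2) - (a - b) ^+ 2 = (a + b) ^+ 2 by ring.
exact: sqr_ge0.
Qed.

Lemma internal_connect k (p q : 'I_(d k)) :
  connect (edge (unweighted (internal GD k))) p q.
Proof.
have [_ /(_ k) [_ /(_ p q)]] := disag.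
by apply: connect_sub => i j ij; apply: connect1; rewrite /edge /= ij ltr01.
Qed.

Lemma deviation_va y k (p : 'I_(d k)) :
  deviation y (va n0 p) ^+ 2 <=
  Wkj GD p
  * laplacian_form (unweighted (internal GD k)) (restrict y k) (restrict y k).
Proof.
have := mean_deviation p (restrict y k) (internal_connect (k := k)).
rewrite /deviation parent_va aggregate_lshift [restrict y k p 0]mxE.
have -> // : \sum_i restrict y k i 0 = \sum_(i < d k) y (va n0 i) 0.
by apply: eq_bigr => i _; rewrite mxE.
Qed.

Lemma E2_cross x z : E2 x z -> parent x != parent z.
Proof.
move=> /(oriented.1)[k [l [p [q [-> -> kl _]]]]].
by rewrite !parent_va eq_lshift.
Qed.

(** The orientation contains exactly one of [(p, q)] and [(q, p)] for each edge between different
    clusters, so the two sums together meet every such edge at [p] once. *)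
Lemma E2_sum k l (p : 'I_(d k)) (c : R) :
  \sum_(q < d l | E2 (va n0 p) (va n0 q)) wt GD (va n0 p) (va n0 q) * c
  + \sum_(q < d l | E2 (va n0 q) (va n0 p)) wt GD (va n0 q) (va n0 p) * c
  = c * \sum_(q < d l | parent (va n0 p) != parent (va n0 q))
          wt GD (va n0 p) (va n0 q).
Proof.
rewrite big_mkcond [X in _ + X]big_mkcond -big_split mulr_sumr [RHS]big_mkcond.
apply: eq_bigr => q _ /=; rewrite [wt GD (va n0 q) _]wt_sym.
have [pq|] := boolP (parent (va n0 p) != parent (va n0 q)); last first.
  rewrite negbK => /eqP pq.
  case: ifP => [/E2_cross|_]; first by rewrite pq eqxx.
  by case: ifP => [/E2_cross|_]; rewrite ?pq ?eqxx ?addr0.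
have [w0|w0] := ltrP 0 (wt GD (va n0 p) (va n0 q)).
  move: pq; rewrite !parent_va eq_lshift => /(oriented.2 _ _ p q)/(_ w0).
  by case: ifP => _; case: ifP => //= _ _; rewrite ?addr0 ?add0r mulrC.
have -> : wt GD (va n0 p) (va n0 q) = 0 by apply/eqP; rewrite eq_le w0 wt_ge0.
by rewrite !(mul0r, mulr0) !if_same addr0.
Qed.

(** The bound is regrouped by the vertex [p] at which an edge leaves the cluster: the factor 2 on
    [E_D^2] and the factor 1 on [E_D^1] are the values of [split_cost]. *)
Lemma internal_boundE eps k :
  internal_bound GD E2 eps k
  = (1 + eps^-1) * \sum_(p < d k) Wkj GD p *
      \sum_(z | parent (va n0 p) != parent z)
         wt GD (va n0 p) z * split_cost (va n0 p) z.
Proof.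
congr (_ * _).
have costE (p : 'I_(d k)) :
    \sum_(z | parent (va n0 p) != parent z)
      wt GD (va n0 p) z * split_cost (va n0 p) z
    = 2 * \sum_(l < m) \sum_(q < d l | parent (va n0 p) != parent (va n0 q))
        wt GD (va n0 p) (va n0 q)
      + \sum_(i < n0) wt GD (va n0 p) (v0 d i).
  rewrite sum_vertices; congr (_ + _).
    rewrite mulr_sumr; apply: eq_bigr => l _; rewrite mulr_sumr.
    by apply: eq_bigr => q _; rewrite split_cost_va mulrC.
  apply: eq_big => [i|i _]; first by rewrite parent_va parent_v0 eq_lrshift.
  by rewrite split_costC split_cost_v0l mulr1.
rewrite [RHS](eq_bigr _ (fun p _ => congr1 (fun t => _ * t) (costE p))).
under [RHS]eq_bigr => p _ do rewrite mulrDr.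
rewrite [RHS]big_split /= [LHS]addrC; congr (_ + _).
  under [RHS]eq_bigr => p _ do rewrite mulrCA mulr_sumr.
  rewrite -mulr_sumr exchange_big; congr (_ * _); apply: eq_bigr => l _.
  rewrite [X in _ + X](exchange_big_dep predT) //= -big_split.
  by apply: eq_bigr => p _; rewrite -E2_sum.
rewrite (exchange_big_dep predT) //=; apply: eq_bigr => p _.
rewrite mulr_sumr [LHS]big_mkcond; apply: eq_bigr => i _ /=.
rewrite wt_sym mulrC; case: ifP => // /negbT; rewrite /edge -leNgt wt_sym => w0.
have -> : wt GD (va n0 p) (v0 d i) = 0 by apply/eqP; rewrite eq_le w0 wt_ge0.
by rewrite mulr0.
Qed.

(** The comparison holds edge by edge, since passing to unit weights keeps the edge set. *)
Lemma internal_energy_ge eps y k :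
  (forall p q : 'I_(d k), edge (internal GD k) p q ->
     internal_bound GD E2 eps k <= wt (internal GD k) p q) ->
  internal_bound GD E2 eps k
    * laplacian_form (unweighted (internal GD k)) (restrict y k) (restrict y k)
  <= laplacian_form (internal GD k) (restrict y k) (restrict y k).
Proof.
move=> wtP; rewrite mulr_sumr; apply: ler_sum => p _.
rewrite mulr_sumr.
have edgeE q : edge (unweighted (internal GD k)) p q = edge (internal GD k) p q.
  by rewrite {1}/edge /= ltr0n lt0b.
rewrite (eq_bigl _ _ (fun q => congr1 (andb _) (edgeE q))).
apply: ler_sum => q /andP[_ pq] /=.
by rewrite pq mul1r -[leRHS]mulrA ler_wpM2r ?wtP // -expr2 sqr_ge0.
Qed.

Lemma cross_sum_deviation y :
  cross_sum (fun x z => split_cost x z * deviation y x ^+ 2)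
  = \sum_(k < m) \sum_(p < d k) deviation y (va n0 p) ^+ 2 *
      \sum_(z | parent (va n0 p) != parent z)
         wt GD (va n0 p) z * split_cost (va n0 p) z.
Proof.
rewrite /cross_sum sum_vertices [X in _ + X]big1 ?addr0 => [|i _]; last first.
  by apply: big1 => z _; rewrite deviation_v0 expr0n !mulr0.
apply: eq_bigr => k _; apply: eq_bigr => p _; rewrite mulr_sumr.
by apply: eq_bigr => z _; rewrite mulrA mulrC.
Qed.

Lemma aggregate_energy_le eps y : 0 < eps ->
  (forall k (p q : 'I_(d k)), edge (internal GD k) p q ->
     internal_bound GD E2 eps k <= wt (internal GD k) p q) ->
  laplacian_form G (aggregate y) (aggregate y)
  <= (1 + eps) * laplacian_form GD y y.
Proof.
move=> eps0 wtP; set Y := aggregate y.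
rewrite -(ler_pM2l (ltr0Sn R 1)) laplacian_form_sum.
rewrite -(cross_sum_parent (fun u v => (Y u 0 - Y v 0) ^+ 2)).
set q := fun x z => (y x 0 - y z 0) ^+ 2.
set h := fun x z => split_cost x z * (deviation y x ^+ 2 + deviation y z ^+ 2).
apply: (@le_trans _ _
  (cross_sum (fun x z => (1 + eps) * q x z + (1 + eps^-1) * h x z))).
  apply: cross_sum_le => x z.
  have := deviation_split y x z; rewrite -/(h x z).
  have -> : Y (parent x) 0 - Y (parent z) 0
          = (y x 0 - y z 0) - (deviation y x - deviation y z).
    by rewrite /deviation -/Y; ring.
  rewrite /q; move: (deviation y x - _) (y x 0 - _) (h x z) => b a t bt.
  have ie0 : 0 < eps^-1 by rewrite invr_gt0.
  apply: (@le_trans _ _ ((1 + eps) * a ^+ 2 + (1 + eps^-1) * b ^+ 2)).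
    rewrite -subr_ge0.
    (* Young's inequality, with its defect written as a multiple of a square. *)
    have -> : (1 + eps) * a ^+ 2 + (1 + eps^-1) * b ^+ 2 - (a - b) ^+ 2
              = eps^-1 * (eps * a + b) ^+ 2.
      by field; rewrite gt_eqF.
    by rewrite mulr_ge0 ?sqr_ge0 // ltW.
  by rewrite lerD2l ler_wpM2l // addr_ge0 // ltW.
rewrite cross_sumD cross_sum_sym; last exact: split_costC.
(* The cross terms with factor [1 + eps] cancel; the deviation terms remain, to be absorbed by the
   internal energy. *)
rewrite [leRHS]mulrCA laplacian_form_split mulrDr lerD2l.
apply: (@le_trans _ _ (2 *
  \sum_k laplacian_form (internal GD k) (restrict y k) (restrict y k))).
  rewrite mulrCA ler_pM2l // cross_sum_deviation mulr_sumr.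
  apply: ler_sum => k _; apply: le_trans (internal_energy_ge y (wtP k)).
  rewrite internal_boundE -mulrA ler_wpM2l ?addr_ge0 ?invr_ge0 ?(ltW eps0) //.
  rewrite mulr_suml; apply: ler_sum => p _; rewrite [leRHS]mulrAC.
  apply: ler_wpM2r (deviation_va y p); apply: sumr_ge0 => z _.
  by rewrite mulr_ge0 ?wt_ge0 ?split_cost_ge0.
(* One copy of the internal energy suffices, and [1 + eps >= 1] copies are available. *)
rewrite ler_peMl // ?lerDl ?(ltW eps0) // mulr_ge0 // sumr_ge0 // => k _.
exact: laplacian_form_ge0.
Qed.
(** [P u] is constant on each cluster, so the internal energy vanishes and the cross differences are
    those of [u]. *)
Lemma laplacian_form_Pmx u :
  laplacian_form GD (Pmx R n0 d *m u) (Pmx R n0 d *m u) = laplacian_form G u u.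
Proof.
apply: (mulfI (lt0r_neq0 (ltr0Sn R 1))).
rewrite laplacian_form_split [X in _ + 2 * X]big1 => [|k _]; last first.
  have -> : restrict (Pmx R n0 d *m u) k = const_mx (u (lshift n0 k) 0).
    by apply/colP=> p; rewrite [LHS]mxE Pmx_mulE parent_va [RHS]mxE.
  exact: laplacian_form_const.
rewrite mulr0 addr0 laplacian_form_sum.
rewrite -(cross_sum_parent (fun i j => (u i 0 - u j 0) ^+ 2)).
by apply: eq_bigr => x _; apply: eq_bigr => z _; rewrite !Pmx_mulE.
Qed.

End Energy.

(** * The fictitious space lemma applied to the disaggregated graph *)

Theorem theorem11 (R : realType) (m n0 : nat) (d : 'I_m -> nat)
    (G : wgraph R (m + n0))
    (GD : wgraph R (\sum_(k < m) d k + n0))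
    (E2 : rel 'I_(\sum_(k < m) d k + n0))
    (eps : R)
    (tBD : 'M[R]_(\sum_(k < m) d k + n0)) :
  (2 <= m + n0)%N ->
  connected_graph G ->
  is_disaggregation G GD ->
  is_oriented_E2 GD E2 ->
  0 < eps ->
  (forall (k : 'I_m) (p q : 'I_(d k)), edge (internal GD k) p q ->
     internal_bound GD E2 eps k <= wt (internal GD k) p q) ->
  spd tBD ->
  let A := laplacian G in
  let AD := laplacian GD in
  let Ds := Dsmx R n0 d in
  let tAD := invmx Ds *m AD *m invmx Ds in
  let tP := Ds *m Pmx R n0 d in
  let B := tP^T *m tBD *m tP in
  cond_number (B *m A) <= (1 + eps) * cond_number (tBD *m tAD).
Proof.
move=> _ _ disag oriented eps0 wtP spdB; lazy zeta.
set A := laplacian G; set AD := laplacian GD; set Ds := Dsmx R n0 d.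
set tAD := invmx Ds *m AD *m invmx Ds; set tP := Ds *m Pmx R n0 d.
have d_gt0 k : (0 < d k)%N by case: (disag.2 k).
have unitDs : Ds \in unitmx by exact: Dsmx_unit.
have symDs : Ds^T = Ds by exact: tr_Dsmx.
have symtAD : tAD^T = tAD.
  by rewrite /tAD !trmx_mul trmx_inv symDs tr_laplacian mulmxA.
have tADE v : dot (tAD *m v) v
    = laplacian_form GD (invmx Ds *m v) (invmx Ds *m v).
  by rewrite -laplacianP -!mulmxA [LHS]dot_mulmxl trmx_inv symDs.
(* The scalings cancel: [tP^T tAD tP = P^T AD P], whose energies are those of [A]. *)
have AE : A = tP^T *m tAD *m tP.
  apply: sym_quadratic_inj => [||u]; first exact: tr_laplacian.
    exact: sym_congr.
  rewrite dot_congr tADE laplacianP -(laplacian_form_Pmx disag).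
  by rewrite /tP !mulmxA mulVmx // mul1mx.
rewrite AE; apply: fictitious_space => // [v|||v].
- by rewrite tADE laplacian_form_ge0.
- exact: scaled_Pmx_orthonormal.
- by rewrite addr_gt0.
- rewrite -AE tADE laplacianP.
  (* With [y = Ds^-1 v], the bound required at [v] becomes the energy estimate for the average of
     [y]. *)
  have -> : tP^T *m v = aggregate (invmx Ds *m v).
    by rewrite -aggregateE // -[v in LHS](mulKVmx unitDs).
  exact: (aggregate_energy_le disag oriented).
Qed.
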